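(* Fix $n\ge 1$. Let the coefficients $v_i[m]$, $w_i[m]$ with $i\in\mathscr N$ and $0\le m\le n-1$ be given, and let the slack coefficient $v_0[n]\in\mathbb C$ be given. Consider the linear system in the unknowns $v_1[n],\dots,v_N[n]$: $$\sum_{j=0}^{N} y^{s}_{ij}\,v_j[n] = S_i^{*}\,w_i^{*}[n-1]-y^{sh}_i\,v_i[n-1],\qquad i\in\mathscr N. \qquad (\star)$$ Let $\tilde{\mathbf I}\in\mathbb C^N$ be the constant vector with entries $I_i=S_i^{*}w_i^{*}[n-1]-y^{sh}_i v_i[n-1]$. Then: (a) if the network is radial, the solution of $(\star)$ is the output $\tilde{\mathbf V}$ of a single iteration of the backward-forward sweep (BFS) algorithm with slack voltage $v_0[n]$ and constant injections $\tilde{\mathbf I}$; (b) if the network is radial or weakly meshed, the solution of $(\star)$ is the output $\tilde{\mathbf V}$ of a single iteration of the direct approach with slack voltage $v_0[n]$ and constant injections $\tilde{\mathbf I}$.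
   Context: Network. A distribution network is a connected graph with nodes $0,1,\dots,N$ and finitely many branches. Node $0$ is the slack node and $\mathscr N=\{1,\dots,N\}$ are the PQ nodes. The network is radial if the graph is a tree (so there are $N$ branches) and weakly meshed if it contains some cycles. Each branch $b$ has a nonzero complex admittance $y_b$, and $\mathbf Y_b$ is the diagonal matrix of branch admittances. Orient each branch and let $\mathbf A$ be the node-to-branch incidence matrix (each column has one entry $+1$, one entry $-1$, and zeros elsewhere), partitioned as $\mathbf A=\begin{pmatrix}\mathbf a_0^T\\ \tilde{\mathbf A}\end{pmatrix}$, where $\mathbf a_0^T$ is the row of the slack node. The bus admittance matrix is $\mathbf Y^s+\mathbf Y^{sh}$, where $\mathbf Y^s=\mathbf A\mathbf Y_b\mathbf A^T=(y^s_{ij})_{0\le i,j\le N}$ is the series part (no shunt elements) and $\mathbf Y^{sh}$ is diagonal with entries $y^{sh}_i$. $S_i\in\mathbb C$ is the constant apparent power at node $i\in\mathscr N$; $^*$ is complex conjugation; $\mathbf 1$ is the all-ones vector in $\mathbb C^N$. Coefficients (Holomorphic Embedding Load flow Method). $v_i[m]$ are the power series coefficients of the voltage at node $i$, with $v_i[0]=V_0\ne 0$ (the slack voltage) for $i\in\mathscr N$, and $w_i[m]$ are the coefficients of the reciprocal series: $w_i[0]=1/v_i[0]$ and $w_i[m]=-\frac{1}{v_i[0]}\sum_{k=0}^{m-1}w_i[k]v_i[m-k]$ for $m\ge1$. A single BFS iteration (radial network) with slack voltage $U_0\in\mathbb C$ and constant injections $\tilde{\mathbf I}\in\mathbb C^N$: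 the backward sweep determines $\mathbf I_b$ from $\tilde{\mathbf A}\mathbf I_b=\tilde{\mathbf I}$; then the forward sweep determines the output $\tilde{\mathbf V}$ from $\mathbf Y_b\tilde{\mathbf A}^T(\tilde{\mathbf V}-U_0\mathbf 1)=\mathbf I_b$. A single iteration of the direct approach with slack voltage $U_0$ and constant injections $\tilde{\mathbf I}$: the output is $\tilde{\mathbf V}=U_0\mathbf 1+\mathrm{DLF}\,\tilde{\mathbf I}$, where $\mathrm{DLF}$ is the following constant $N\times N$ matrix. Choose a spanning tree $T$ of the network, and let $P_i$ be the set of branches on the path in $T$ from node $0$ to node $i$. Let $\mathrm{BIBC}$ be the matrix (rows: branches of $T$; columns: PQ nodes) with entry $1$ at $(b,i)$ if $b\in P_i$ and $0$ otherwise, let $\mathrm{BCBV}$ be the matrix (rows: PQ nodes; columns: branches of $T$) with entry $1/y_b$ at $(i,b)$ if $b\in P_i$ and $0$ otherwise, and let $\mathbf D=\mathrm{BCBV}\times\mathrm{BIBC}$. If the network is radial, $\mathrm{DLF}=\mathbf D$. If it is weakly meshed, let $L$ be the set of branches not in $T$, $\tilde{\mathbf A}_L$ the submatrix of columns of $\tilde{\mathbf A}$ indexed by $L$, and $\mathbf Z_L$ the diagonal matrix with entries $1/y_b$, $b\in L$; then (Kron reduction eliminating the loop currents) $\mathrm{DLF}=\mathbf D-\mathbf D\tilde{\mathbf A}_L(\mathbf Z_L+\tilde{\mathbf A}_L^T\mathbf D\tilde{\mathbf A}_L)^{-1}\tilde{\mathbf A}_L^T\mathbf D$, where the inverse is assumed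 to exist (so that the direct approach is defined). *)

(* Defs.v *)
From mathcomp Require Import all_boot all_order all_algebra.
From mathcomp Require Import boolp reals complex.

Set Implicit Arguments.
Unset Strict Implicit.
Unset Printing Implicit Defensive.

Import Order.TTheory GRing.Theory Num.Theory.
Local Open Scope ring_scope.

(* Nodes are the elements of 'I_(1 + N), the slack node being ord0. Parallel
   branches are allowed (two of them form a cycle), self-loops are not. *)
Record graph (N : nat) := Graph {
  nbranch : nat;
  src : 'I_nbranch -> 'I_(1 + N);
  tgt : 'I_nbranch -> 'I_(1 + N);
  src_neq_tgt : forall b, src b != tgt b
}.

Section Graph.
Variables (N : nat) (G : graph N).

Definition joins (b : 'I_(nbranch G)) (u v : 'I_(1 + N)) : bool :=
  ((src b == u) && (tgt b == v)) || ((src b == v) && (tgt b == u)).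

(* A walk from u is the list of its steps (branch taken, node reached);
   branches may be traversed against their orientation. *)
Fixpoint walk (T : {set 'I_(nbranch G)}) (u : 'I_(1 + N))
    (p : seq ('I_(nbranch G) * 'I_(1 + N))) : bool :=
  if p is (b, v) :: p' then [&& b \in T, joins b u v & walk T v p'] else true.

Definition simple_path (T : {set 'I_(nbranch G)}) (u v : 'I_(1 + N))
    (p : seq ('I_(nbranch G) * 'I_(1 + N))) : bool :=
  [&& walk T u p, last u (unzip2 p) == v & uniq (u :: unzip2 p)].

Definition cycle_at (T : {set 'I_(nbranch G)}) (u : 'I_(1 + N))
    (p : seq ('I_(nbranch G) * 'I_(1 + N))) : bool :=
  [&& p != [::], walk T u p, last u (unzip2 p) == u,
      uniq (unzip2 p) & uniq (unzip1 p)].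

Definition has_cycle (T : {set 'I_(nbranch G)}) : Prop :=
  exists u p, cycle_at T u p.

Definition connected (T : {set 'I_(nbranch G)}) : Prop :=
  forall u v, connect [rel x y | [exists b in T, joins b x y]] u v.

(* The graph with all the nodes and the branches in T is a tree. *)
Definition spanning_tree (T : {set 'I_(nbranch G)}) : Prop :=
  connected T /\ ~ has_cycle T.

Definition radial : Prop := spanning_tree [set: 'I_(nbranch G)].

Definition weakly_meshed : Prop := has_cycle [set: 'I_(nbranch G)].

(* The PQ node i + 1. *)
Definition pq (i : 'I_N) : 'I_(1 + N) := rshift 1 i.

(* When T is a spanning tree there is exactly one path p to consider. *)
Definition path_branches (T : {set 'I_(nbranch G)}) (i : 'I_N) :
    {set 'I_(nbranch G)} :=
  [set b | `[< exists2 p, simple_path T ord0 (pq i) p & b \in unzip1 p >]].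

End Graph.

Record network (K : fieldType) (N : nat) := Network {
  graph_of :> graph N;
  graph_connected : connected [set: 'I_(nbranch graph_of)];
  y : 'I_(nbranch graph_of) -> K;
  y_neq0 : forall b, y b != 0;
  ysh : 'I_(1 + N) -> K
}.

Section Network.
Variables (K : fieldType) (N : nat) (G : network K N).

Definition incidence : 'M[K]_(1 + N, nbranch G) :=
  \matrix_(i, b) ((i == src b)%:R - (i == tgt b)%:R).

Definition red_incidence : 'M[K]_(N, nbranch G) := dsubmx incidence.

Definition Yb : 'M[K]_(nbranch G) := diag_mx (\row_b y b).

Definition Ys : 'M[K]_(1 + N) := incidence *m Yb *m incidence^T.

(* Equations for the PQ nodes only; V holds the unknown PQ voltages and u is
   the slack voltage. *)
Definition pq_system (u : K) (I V : 'cV[K]_N) : Prop :=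
  forall i : 'I_N,
    \sum_(j < 1 + N) Ys (pq i) j * (col_mx u%:M V) j 0 = I i 0.

Definition backward_sweep (I : 'cV[K]_N) (Ib : 'cV[K]_(nbranch G)) : Prop :=
  red_incidence *m Ib = I.

Definition forward_sweep (u : K) (Ib : 'cV[K]_(nbranch G)) (V : 'cV[K]_N) :
    Prop :=
  Yb *m red_incidence^T *m (V - u *: const_mx 1) = Ib.

(* "unique" expresses that each sweep determines its result. *)
Definition bfs_output (u : K) (I V : 'cV[K]_N) : Prop :=
  exists Ib, unique (backward_sweep I) Ib /\ unique (forward_sweep u Ib) V.

Section DirectApproach.
Variable T : {set 'I_(nbranch G)}.

Definition BIBC : 'M[K]_(#|T|, N) :=
  \matrix_(k, i) (enum_val k \in path_branches T i)%:R.

Definition BCBV : 'M[K]_(N, #|T|) :=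
  \matrix_(i, k)
    (if enum_val k \in path_branches T i then (y (enum_val k))^-1 else 0).

Definition Dmx : 'M[K]_N := BCBV *m BIBC.

Definition link_incidence : 'M[K]_(N, #|~: T|) :=
  colsub (fun k : 'I_#|~: T| => enum_val k) red_incidence.

Definition ZL : 'M[K]_(#|~: T|) := diag_mx (\row_k (y (enum_val k))^-1).

Definition loop_impedance : 'M[K]_(#|~: T|) :=
  ZL + link_incidence^T *m Dmx *m link_incidence.

Definition DLF : 'M[K]_N :=
  if `[< radial G >] then Dmx
  else Dmx - Dmx *m link_incidence *m invmx loop_impedance
               *m link_incidence^T *m Dmx.

Definition direct_output (u : K) (I : 'cV[K]_N) : 'cV[K]_N :=
  u *: const_mx 1 + DLF *m I.

End DirectApproach.
End Network.

(* v i m and w i m are the order-m coefficients at the PQ node i + 1. *)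
Definition injections (R : realType) (N : nat) (G : network R[i] N)
    (S : 'I_N -> R[i]) (v w : 'I_N -> nat -> R[i]) (n : nat) : 'cV[R[i]]_N :=
  \col_i ((S i)^* * (w i n.-1)^* - ysh G (pq i) * v i n.-1).

(* Main.v *)
Require Import Defs.
From mathcomp Require Import all_boot all_order all_algebra.
From mathcomp Require Import boolp reals complex.

Set Implicit Arguments.
Unset Strict Implicit.
Unset Printing Implicit Defensive.

Import Order.TTheory GRing.Theory Num.Theory.
Local Open Scope ring_scope.

(** Since the columns of the incidence matrix A sum to zero, the system only
    sees the voltages relative to the slack node: with B the reduced incidence
    matrix it reads B Yb B^T (V - u 1) = I ([pq_systemE]).  Everything then
    follows from the invertibility of B on a spanning tree T, and the inverse
    is explicit.

    Removing a branch b of T splits the tree in two, and the path from the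
    slack node to x uses b exactly when x is cut off from the slack node
    ([mem_path_branchesE]).  The indicator of the part that is cut off is a
    potential that is constant along every other branch of T and jumps by
    +1 or -1 along b.  With that sign as a factor, these indicators are the
    rows of a left inverse M of B_T, the submatrix of B formed by the columns
    in T ([cut_red_incidence]).  Also B_T has independent rows: a potential
    that vanishes at the slack node and is constant along the branches of T is
    zero, because T is connected ([grounded_potential_eq0]).  So M is a
    two-sided inverse.

    For a radial network, T consists of all the branches, so B is invertible
    and each of the two sweeps solves a linear system whose matrix is
    invertible; chaining them solves B Yb B^T (V - u 1) = I.  For the direct
    approach, BIBC is M up to the signs of its rows, and each sign occurs
    squared in D = BCBV BIBC, so D = M^T Z_T M is the inverse of
    B_T Y_T B_T^T ([tree_laplacianK]).  The branches outside T perturb this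
    matrix by B_L Y_L B_L^T, and the Kron reduction formula is the Woodbury
    identity for this perturbation ([woodbury]). *)

(** * Cuts of a spanning tree *)

Section Cuts.
Variables (N : nat) (G : graph N).
Implicit Types (T : {set 'I_(nbranch G)}) (b : 'I_(nbranch G)).
Implicit Types (u v x : 'I_(1 + N)).
Implicit Types (p : seq ('I_(nbranch G) * 'I_(1 + N))).

Definition adjacent T : rel 'I_(1 + N) :=
  [rel x y | [exists b in T, joins b x y]].

Lemma joins_sym b u v : joins b u v = joins b v u.
Proof. exact: orbC. Qed.

Lemma connect_adjacentC T : connect_sym (adjacent T).
Proof.
apply: sym_connect_sym => u v /=.
by apply: eq_existsb => b; rewrite joins_sym.
Qed.

Lemma joins_adjacent T b u v : b \in T -> joins b u v -> adjacent T u v.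
Proof. by move=> bT buv; apply/existsP; exists b; rewrite bT. Qed.

Lemma joins_connect T b u v : b \in T -> joins b u v -> connect (adjacent T) u v.
Proof. by move=> bT /(joins_adjacent bT); exact: connect1. Qed.

Lemma joins_src_tgt b : joins b (src b) (tgt b).
Proof. by rewrite /joins !eqxx. Qed.

Lemma joinsP b u v : joins b u v ->
  (src b = u /\ tgt b = v) \/ (src b = v /\ tgt b = u).
Proof. by case/orP => /andP[/eqP-> /eqP->]; [left|right]. Qed.

Lemma subset_connect T T' u v : T \subset T' ->
  connect (adjacent T) u v -> connect (adjacent T') u v.
Proof.
move=> sTT'; apply: connect_sub => x z /existsP[b /andP[bT bxz]].
exact: joins_connect (subsetP sTT' _ bT) bxz.
Qed.

Lemma walk_of_path T u (s : seq 'I_(1 + N)) : path (adjacent T) u s ->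
  exists2 p, walk T u p & unzip2 p = s.
Proof.
elim: s u => [|v s IHs] u /=; first by exists [::].
case/andP=> /existsP[b /andP[bT buv]] /IHs[p wp <-].
by exists ((b, v) :: p); rewrite //= bT buv.
Qed.

Lemma connect_simple_path T u v : connect (adjacent T) u v ->
  exists p, simple_path T u v p.
Proof.
case/connectP=> s0 path_s0 ->; case/shortenP: path_s0 => s path_s uniq_s _.
have [p wp ps] := walk_of_path path_s.
by exists p; rewrite /simple_path wp ps eqxx uniq_s.
Qed.

Lemma walk_connect T T' u p : walk T u p ->
  {subset unzip1 p <= T'} -> connect (adjacent T') u (last u (unzip2 p)).
Proof.
elim: p u => [|[b v] p IHp] u //= /and3P[_ buv wp] sub.
apply: connect_trans (IHp v wp _).
  by apply: joins_connect buv; apply: sub; rewrite mem_head.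
by move=> c cp; apply: sub; rewrite inE cp orbT.
Qed.

Lemma walk_cat T u p1 p2 :
  walk T u (p1 ++ p2) = walk T u p1 && walk T (last u (unzip2 p1)) p2.
Proof. by elim: p1 u => [|[b v] p1 IHp] u //=; rewrite IHp !andbA. Qed.

Lemma walk_branches T u p : walk T u p -> {subset unzip1 p <= T}.
Proof.
elim: p u => [|[b v] p IHp] u //= /and3P[bT _ /IHp sub] c.
by rewrite inE => /orP[/eqP->|/sub].
Qed.

Lemma walk_branch_end T u p b : walk T u p -> b \in unzip1 p ->
  exists x v, joins b x v /\ v \in unzip2 p.
Proof.
elim: p u => [|[c z] p IHp] u //= /and3P[_ cuz wp].
rewrite inE => /orP[/eqP->|/(IHp _ wp)[x [v [bxv vp]]]].
  by exists u, z; rewrite inE eqxx.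
by exists x, v; rewrite inE vp orbT.
Qed.

(** A second traversal of a branch would end at one of the two nodes already
    met in the first one. *)
Lemma uniq_branches T u p : walk T u p -> uniq (u :: unzip2 p) ->
  uniq (unzip1 p).
Proof.
elim: p u => [|[b v] p IHp] u //= /and3P[_ buv wp].
rewrite inE negb_or => /and3P[/andP[_ uNp] vNp uniq_p].
rewrite (IHp v wp) /= ?vNp ?uniq_p // andbT.
apply/negP=> /(walk_branch_end wp)[x [z [bxz zp]]].
move: uNp vNp; case: (joinsP buv) => [] [<- <-]; case: (joinsP bxz) => [] [-> ->];
  by rewrite zp.
Qed.

(** Closing a simple path from [src b] to [tgt b] with b gives a cycle; the
    path avoids b, so the branches of the cycle are distinct. *)
Lemma connect_has_cycle T b : b \in T ->
  connect (adjacent (T :\ b)) (src b) (tgt b) -> has_cycle T.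
Proof.
move=> bT /connect_simple_path[p /and3P[wp /eqP last_p uniq_p]].
exists (src b), (rcons p (b, src b)).
have sub := walk_branches wp.
have wTp u : walk (T :\ b) u p -> walk T u p.
  elim: {wp last_p uniq_p sub} p u => [|[c v] p IHp] u //= /and3P[].
  by case/setD1P=> _ -> -> /IHp.
rewrite /cycle_at -cats1 walk_cat (wTp _ wp) /= last_p bT joins_sym.
rewrite joins_src_tgt /= /unzip1 /unzip2 !map_cat !cats1 last_rcons eqxx !rcons_uniq.
rewrite -/(unzip2 p) -/(unzip1 p) (uniq_branches wp uniq_p) andbT.
have -> : b \notin unzip1 p by apply/negP=> /sub; rewrite !inE eqxx.
by move: uniq_p => /= ->; case: (p).
Qed.

Definition cut_off T b x : bool := ~~ connect (adjacent (T :\ b)) ord0 x.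

Lemma cut_off_slack T b : cut_off T b ord0 = false.
Proof. by rewrite /cut_off connect0. Qed.

Lemma cut_off_other T b c : c \in T -> c != b ->
  cut_off T b (src c) = cut_off T b (tgt c).
Proof.
move=> cT cb; congr negb; apply: (same_connect_r (@connect_adjacentC _)).
by apply: joins_connect (joins_src_tgt c); rewrite !inE cb.
Qed.

Lemma tree_branch_cut T b u v : spanning_tree T -> b \in T -> joins b u v ->
  ~~ connect (adjacent (T :\ b)) u v.
Proof.
move=> [_ acyclic] bT buv; apply/negP => uv; apply: acyclic.
apply: (connect_has_cycle bT).
by case: (joinsP buv) => [] [-> ->] //; rewrite connect_adjacentC.
Qed.

(** If both ends were cut off, no branch of T would leave the component of
    the slack node; if neither were, b would close a cycle. *)
Lemma cut_off_ends T b : spanning_tree T -> b \in T ->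
  cut_off T b (src b) = ~~ cut_off T b (tgt b).
Proof.
move=> treeT bT; rewrite /cut_off.
have [src0|Nsrc0] := boolP (connect _ ord0 (src b));
  have [tgt0|Ntgt0] := boolP (connect _ ord0 (tgt b)) => //=.
- have := tree_branch_cut treeT bT (joins_src_tgt b).
  by rewrite (connect_trans _ tgt0) // connect_adjacentC.
- have [connT _] := treeT; case/negP: (Nsrc0).
  have: connect (adjacent T) ord0 (src b) by exact: connT.
  have closedT : closed (adjacent T) (connect (adjacent (T :\ b)) ord0).
    apply: intro_closed; first exact: connect_adjacentC.
    move=> x z /existsP[c /andP[cT cxz]]; rewrite -!topredE /= => x0.
    have [cb|cb] := eqVneq c b; last first.
      by apply: connect_trans x0 (joins_connect _ cxz); rewrite !inE cb.
    rewrite {c}cb in cT cxz.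
    by move: Nsrc0 Ntgt0; case: (joinsP cxz) => [] [-> ->]; rewrite x0.
  by move/(closed_connect closedT); rewrite -!topredE /= => <-; exact: connect0.
Qed.

(** A path through b cannot reach a node i that is not cut off: its parts before
    and after b avoid b, so with a b-free path from the slack node to i they
    would join the ends of b. Conversely, a path that avoids b survives the
    removal of b. *)
Lemma mem_path_branchesE T b (i : 'I_N) : spanning_tree T -> b \in T ->
  (b \in path_branches T i) = cut_off T b (pq i).
Proof.
move=> treeT bT; rewrite inE; apply/asboolP/idP.
- case=> p /and3P[wp /eqP last_p uniq_p] bp; apply/negP=> conn.
  have uniq_b := uniq_branches wp uniq_p.
  case/mapP: bp => -[b' v] /splitPr bp /= eb; rewrite -{b'}eb in bp.
  case: bp => p1 p2 in wp last_p uniq_p uniq_b *.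
  move: wp; rewrite walk_cat => /andP[wp1 /and3P[_ joins_b wp2]].
  move: uniq_b last_p; rewrite /unzip1 /unzip2 !map_cat last_cat /=.
  rewrite -/(unzip1 p1) -/(unzip1 p2) -/(unzip2 p1) -/(unzip2 p2).
  rewrite uniq_catC cat_uniq /= => /and3P[/andP[bNp2 _] disj _] last_p.
  have sub1 : {subset unzip1 p1 <= T :\ b}.
    move=> c cp; rewrite !inE (walk_branches wp1) // andbT.
    by apply: contraNneq disj => <-; apply/hasP; exists c; rewrite ?inE ?eqxx.
  have sub2 : {subset unzip1 p2 <= T :\ b}.
    move=> c cp; rewrite !inE (walk_branches wp2) // andbT.
    by apply: contraNneq bNp2 => <-.
  have c1 := walk_connect wp1 sub1.
  have c2 := walk_connect wp2 sub2.
  case/negP: (tree_branch_cut treeT bT joins_b).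
  rewrite connect_adjacentC in c1; apply: connect_trans c1 _.
  by apply: connect_trans conn _; rewrite connect_adjacentC -last_p.
- move=> cut.
  have [connT _] := treeT.
  have [p sp] := connect_simple_path (connT ord0 (pq i)).
  exists p => //; apply: contraNT cut => bNp.
  case/and3P: sp => wp /eqP <- _; apply: (walk_connect wp) => c cp.
  by rewrite !inE (walk_branches wp) // andbT; apply: contraNneq bNp => <-.
Qed.

(** T already connects the ends of any further branch, which would close a
    cycle. *)
Lemma radial_tree_setT T : radial G -> spanning_tree T -> T = setT.
Proof.
move=> [_ acyclic] [connT _]; apply/setP=> b; rewrite inE.
apply/negPn/negP=> bNT; apply: acyclic; apply: (connect_has_cycle (in_setT b)).
apply: subset_connect (connT _ _); apply/subsetP=> c cT.
by rewrite !inE andbT; apply: contraNneq bNT => <-.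
Qed.

End Cuts.

(** * Inverse of a perturbed matrix *)

(** With X the matrix that is inverted, C' D C = X - Z, so that
    Y (C' D C) X^-1 = Y - X^-1: this is what makes the terms other than L D
    cancel in the expanded product. *)
Lemma woodbury (R : comUnitRingType) n k (L D : 'M[R]_n)
    (C : 'M[R]_(n, k)) (C' : 'M[R]_(k, n)) (Y Z : 'M[R]_k) :
  L *m D = 1%:M -> Y *m Z = 1%:M -> Z + C' *m D *m C \in unitmx ->
  (L + C *m Y *m C') *m
    (D - D *m C *m invmx (Z + C' *m D *m C) *m C' *m D) = 1%:M.
Proof.
move=> LD YZ unitX; set X := Z + _; set W := invmx X.
have YXW : Y *m (C' *m D *m C) *m W = Y - W.
  have -> : C' *m D *m C = X - Z by rewrite /X addrC addKr.
  by rewrite mulmxBr YZ mulmxBl mul1mx -mulmxA mulmxV // mulmx1.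
rewrite mulmxBr !mulmxDl -!mulmxA LD (mulmxA L) LD mul1mx.
have -> : Y *m (C' *m (D *m (C *m (W *m (C' *m D))))) = (Y - W) *m (C' *m D).
  by rewrite -YXW !mulmxA.
by rewrite mulmxBl mulmxBr addrCA subrr addr0 addrK.
Qed.

(** * The reduced incidence matrix *)

Section Incidence.
Variables (K : fieldType) (N : nat) (G : network K N).
Implicit Types (T A : {set 'I_(nbranch G)}) (b c : 'I_(nbranch G)).

Local Notation B := (red_incidence G).

Lemma mul_incidence m (M : 'M[K]_(m, 1 + N)) k b :
  (M *m incidence G) k b = M k (src b) - M k (tgt b).
Proof.
rewrite mxE; under eq_bigr do rewrite mxE mulrBr.
rewrite sumrB (bigD1 (src b)) //= eqxx mulr1 big1 ?addr0; last first.
  by move=> i /negPf->; rewrite mulr0.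
rewrite (bigD1 (tgt b)) //= eqxx mulr1 big1 ?addr0 //.
by move=> i /negPf->; rewrite mulr0.
Qed.

Lemma mul_red_incidence m (M : 'M[K]_(m, N)) :
  M *m B = row_mx (0 : 'M_(m, 1)) M *m incidence G.
Proof. by rewrite -[incidence G]vsubmxK mul_row_col mul0mx add0r. Qed.

(** The rows of M are potentials that vanish at the slack node. Along the
    branches of a connected graph, only constants have no drop. *)
Lemma grounded_potential_eq0 T m (M : 'M[K]_(m, N)) : connected T ->
  (forall k b, b \in T -> (M *m B) k b = 0) -> M = 0.
Proof.
move=> connT drop0; apply/matrixP=> k i; rewrite mxE.
pose z x := row_mx (0 : 'M_(m, 1)) M k x.
have z0 : z ord0 = 0.
  have <- : lshift N ord0 = ord0 :> 'I_(1 + N) by exact: val_inj.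
  by rewrite /z row_mxEl mxE.
have -> : M k i = z (pq i) by rewrite /z row_mxEr.
have closed_z : closed (adjacent T) [pred x | z x == 0].
  apply: intro_closed; first exact: connect_adjacentC.
  move=> u v /existsP[b /andP[bT buv]]; rewrite !inE => zu.
  have /eqP : z (src b) - z (tgt b) = 0.
    by rewrite -(drop0 k b bT) mul_red_incidence mul_incidence.
  rewrite subr_eq0 => /eqP ez.
  by case: (joinsP buv) => [] [su tv]; rewrite su tv in ez; rewrite ?ez // -ez.
have := closed_connect closed_z (connT ord0 (pq i)).
by rewrite !inE z0 eqxx => /esym/eqP.
Qed.

Definition cut_sign T b : K :=
  (cut_off T b (src b))%:R - (cut_off T b (tgt b))%:R.

Definition cut_mx T : 'M[K]_(nbranch G, N) :=
  \matrix_(b, i) (cut_sign T b * (cut_off T b (pq i))%:R).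

Lemma cut_sign_sqr T b : spanning_tree T -> b \in T ->
  cut_sign T b * cut_sign T b = 1.
Proof.
move=> treeT bT; rewrite /cut_sign (cut_off_ends treeT bT).
by case: cut_off; rewrite ?subr0 ?sub0r ?mulrNN mulr1.
Qed.

(** Row b of [cut_mx T] is, up to sign, the potential equal to 1 on the part
    cut off by b and to 0 on the other part: its drop along b is the sign
    itself, and its drop along another branch of T is zero. *)
Lemma cut_red_incidence T b c : spanning_tree T -> b \in T -> c \in T ->
  (cut_mx T *m B) b c = (b == c)%:R.
Proof.
move=> treeT bT cT; rewrite mul_red_incidence mul_incidence.
have E x : row_mx (0 : 'M_(_, 1)) (cut_mx T) b x
           = cut_sign T b * (cut_off T b x)%:R.
  case: (split_ordP x) => j ->; rewrite ?row_mxEl ?row_mxEr mxE //.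
  by rewrite (_ : lshift N j = ord0) ?cut_off_slack ?mulr0 // ord1; exact: val_inj.
rewrite !E -mulrBr; have [<-|bc] := eqVneq; first exact: cut_sign_sqr.
by rewrite (cut_off_other cT) 1?eq_sym // subrr mulr0.
Qed.

Definition incidence_on A : 'M[K]_(N, #|A|) :=
  colsub (fun k : 'I_#|A| => enum_val k) B.

Definition admittance_on A : 'M[K]_#|A| := diag_mx (\row_k y (enum_val k)).

Definition impedance_on A : 'M[K]_#|A| := diag_mx (\row_k (y (enum_val k))^-1).

Definition laplacian_on A : 'M[K]_N :=
  incidence_on A *m admittance_on A *m (incidence_on A)^T.

Definition laplacian : 'M[K]_N := B *m Yb G *m B^T.

Definition tree_cut T : 'M[K]_(#|T|, N) :=
  rowsub (fun k : 'I_#|T| => enum_val k) (cut_mx T).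

Lemma admittanceK A : admittance_on A *m impedance_on A = 1%:M.
Proof.
rewrite mulmx_diag -diag_const_mx; congr diag_mx; apply/rowP=> k.
by rewrite !mxE mulfV ?y_neq0.
Qed.

Lemma laplacian_onE A i j :
  laplacian_on A i j = \sum_(b in A) B i b * y b * B j b.
Proof.
rewrite big_enum_val /laplacian_on mul_mx_diag mxE.
by apply: eq_bigr => k _; rewrite !mxE.
Qed.

Lemma laplacian_split T : laplacian = laplacian_on T + laplacian_on (~: T).
Proof.
apply/matrixP=> i j; rewrite [RHS]mxE !laplacian_onE /laplacian mul_mx_diag mxE.
rewrite (bigID (mem T)) /=; congr (_ + _).
  by apply: eq_bigr => b _; rewrite !mxE.
by apply: eq_big => [b|b _]; rewrite ?inE ?mxE.
Qed.

Lemma tree_cutK T : spanning_tree T -> tree_cut T *m incidence_on T = 1%:M.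
Proof.
move=> treeT; rewrite mul_rowsub_mx mulmx_colsub; apply/matrixP=> k l.
rewrite 2!mxE cut_red_incidence ?enum_valP // mxE.
by rewrite (inj_eq enum_val_inj).
Qed.

Lemma tree_incidenceK T : spanning_tree T -> incidence_on T *m tree_cut T = 1%:M.
Proof.
move=> treeT; have [connT _] := treeT.
(* The left inverse gives B_T M B_T = B_T, and the rows of B_T are free. *)
apply/eqP; rewrite -subr_eq0; apply/eqP; apply: (grounded_potential_eq0 connT).
move=> k b bT; set M := _ - _.
have : (M *m incidence_on T) k (enum_rank_in bT b) = 0.
  by rewrite mulmxBl -mulmxA tree_cutK // mulmx1 mul1mx subrr mxE.
by rewrite mulmx_colsub mxE enum_rankK_in.
Qed.

(** Both [BCBV] and [BIBC] are built from the unsigned cut matrix; the signs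
    can be put back because they are squared in the product. *)
Lemma Dmx_cut T : spanning_tree T ->
  Dmx T = (tree_cut T)^T *m impedance_on T *m tree_cut T.
Proof.
move=> treeT; rewrite mul_mx_diag; apply/matrixP=> i j; rewrite !mxE.
apply: eq_bigr => k _; have kT := enum_valP k; rewrite !mxE.
rewrite !(mem_path_branchesE _ treeT kT).
rewrite -[X in _ = X * _]mulrA mulrACA cut_sign_sqr // mul1r.
by case: (cut_off T _ (pq i)); rewrite ?mul1r ?mul0r.
Qed.

(** D inverts the three factors of the Laplacian of T one at a time. *)
Lemma tree_laplacianK T : spanning_tree T -> laplacian_on T *m Dmx T = 1%:M.
Proof.
move=> treeT; rewrite Dmx_cut // /laplacian_on.
have trK : (incidence_on T)^T *m (tree_cut T)^T = 1%:M.
  by rewrite -trmx_mul tree_cutK // trmx1.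
rewrite -!mulmxA (mulmxA (_^T) (_^T)) trK mul1mx (mulmxA (admittance_on T)).
by rewrite admittanceK mul1mx tree_incidenceK.
Qed.

Lemma radial_laplacianK T : radial G -> spanning_tree T ->
  laplacian *m Dmx T = 1%:M.
Proof.
move=> radG treeT.
rewrite (laplacian_split T) [X in _ + X](_ : _ = 0) ?addr0 ?tree_laplacianK //.
apply/matrixP=> i j; rewrite laplacian_onE [RHS]mxE big_pred0 // => b.
by rewrite (radial_tree_setT radG treeT) !inE.
Qed.

Lemma DLF_laplacianK T : spanning_tree T -> radial G \/ weakly_meshed G ->
  (weakly_meshed G -> loop_impedance T \in unitmx) ->
  laplacian *m DLF T = 1%:M.
Proof.
move=> treeT topology unitZ; rewrite /DLF.
case: asboolP => [radG|NradG]; first exact: radial_laplacianK.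
case: topology => [//|/unitZ {}unitZ]; rewrite (laplacian_split T).
by apply: woodbury unitZ; [exact: tree_laplacianK | exact: admittanceK].
Qed.

(** * The power flow system and the sweeps *)

(** A common shift of all the nodes, slack included, does not change the drops
    along the branches, so the slack voltage can be moved to zero. *)
Lemma pq_systemE u (I V : 'cV[K]_N) :
  pq_system G u I V <-> laplacian *m (V - u *: const_mx 1) = I.
Proof.
set X := V - _.
have E : (incidence G)^T *m col_mx u%:M V = B^T *m X.
  have -> : col_mx u%:M V = u *: const_mx 1 + col_mx (0 : 'M_1) X.
    rewrite -(vsubmxK (const_mx 1)) scale_col_mx add_col_mx addr0 /X addrC.
    congr col_mx.
      by apply/matrixP=> i j; rewrite !mxE !ord1 mulr1.
    rewrite (_ : dsubmx _ = const_mx 1) ?subrK //.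
    by apply/matrixP=> i j; rewrite !mxE.
  rewrite mulmxDr -scalemxAr [X in _ *: X](_ : _ = 0) ?scaler0 ?add0r.
    by rewrite -{1}[incidence G]vsubmxK tr_col_mx mul_row_col mulmx0 add0r.
  apply: trmx_inj; rewrite trmx_mul trmxK trmx0; apply/matrixP=> k b.
  by rewrite mul_incidence !mxE subrr.
have {}E i : \sum_(j < 1 + N) Ys G (pq i) j * col_mx u%:M V j 0
             = (laplacian *m X) i 0.
  transitivity ((Ys G *m col_mx u%:M V) (pq i) 0); first by rewrite mxE.
  rewrite /Ys -!mulmxA E -[incidence G]vsubmxK mul_col_mx col_mxEd.
  by rewrite /laplacian !mulmxA.
split=> [sys|<-] => [|i]; last by rewrite E.
by apply/matrixP=> i j; rewrite ord1 -sys E.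
Qed.

Lemma pq_system_unique u (I : 'cV[K]_N) (X : 'M[K]_N) :
  laplacian *m X = 1%:M -> unique (pq_system G u I) (u *: const_mx 1 + X *m I).
Proof.
move=> LX; split.
  by apply/pq_systemE; rewrite addrAC subrr add0r mulmxA LX mul1mx.
move=> V /pq_systemE <-; rewrite mulmxA (mulmx1C LX) mul1mx.
by rewrite addrC subrK.
Qed.

(** On a radial network B is invertible, with inverse M, so the backward sweep
    gives M I and the forward sweep u 1 + M^T Yb^-1 (M I). *)
Lemma bfs_solution u (I : 'cV[K]_N) : radial G ->
  exists V, unique (pq_system G u I) V /\ bfs_output G u I V.
Proof.
move=> treeG; pose M := cut_mx setT; have [connG _] := treeG.
have MB : M *m B = 1%:M.
  by apply/matrixP=> b c; rewrite cut_red_incidence ?mxE ?inE.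
have BM : B *m M = 1%:M.
  apply/eqP; rewrite -subr_eq0; apply/eqP.
  apply: (grounded_potential_eq0 connG) => k b _.
  by rewrite mulmxBl -mulmxA MB mulmx1 mul1mx subrr mxE.
pose Zb : 'M[K]_(nbranch G) := diag_mx (\row_b (y b)^-1).
have YZ : Yb G *m Zb = 1%:M.
  rewrite mulmx_diag -diag_const_mx; congr diag_mx; apply/rowP=> k.
  by rewrite !mxE mulfV ?y_neq0.
have MBt : M^T *m B^T = 1%:M by rewrite -trmx_mul BM trmx1.
have BMt : B^T *m M^T = 1%:M by rewrite -trmx_mul MB trmx1.
have YBX : Yb G *m B^T *m (M^T *m Zb) = 1%:M.
  by rewrite -mulmxA (mulmxA B^T) BMt mul1mx.
have XYB : M^T *m Zb *m (Yb G *m B^T) = 1%:M.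
  by rewrite -mulmxA (mulmxA Zb) (mulmx1C YZ) mul1mx.
exists (u *: const_mx 1 + M^T *m Zb *m M *m I); split.
  apply: pq_system_unique.
  by rewrite /laplacian -!(mulmxA B) (mulmxA (Yb G *m B^T)) YBX mul1mx.
exists (M *m I); split; split.
- by rewrite /backward_sweep mulmxA BM mul1mx.
- by move=> Ib <-; rewrite mulmxA MB mul1mx.
- rewrite /forward_sweep addrAC subrr add0r -[_ *m M *m I]mulmxA mulmxA.
  by rewrite YBX mul1mx.
- move=> V fs; have {fs} : Yb G *m B^T *m (V - u *: const_mx 1) = M *m I := fs.
  rewrite -[_ *m M *m I]mulmxA => <-.
  by rewrite mulmxA XYB mul1mx addrC subrK.
Qed.

End Incidence.

Theorem proposition1 (R : realType) (N : nat) (G : network R[i] N)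
  (S : 'I_N -> R[i]) (n : nat) (n_ge1 : (1 <= n)%N)
  (V0 : R[i]) (V0_neq0 : V0 != 0)
  (v w : 'I_N -> nat -> R[i])
  (v_0 : forall i, v i 0%N = V0)
  (w_0 : forall i, w i 0%N = 1 / v i 0%N)
  (w_rec : forall i m, (1 <= m <= n - 1)%N ->
     w i m = - (1 / v i 0%N) * \sum_(k < m) w i k * v i (m - k)%N)
  (v0n : R[i]) :
  let I := injections G S v w n in
  (radial G ->
     exists V, unique (pq_system G v0n I) V /\ bfs_output G v0n I V)
  /\
  (radial G \/ weakly_meshed G ->
     forall T : {set 'I_(nbranch G)}, spanning_tree T ->
     (weakly_meshed G -> loop_impedance T \in unitmx) ->
     unique (pq_system G v0n I) (direct_output T v0n I)).
Proof.
move=> I; split=> [radG|topology T treeT unitZ]; first exact: bfs_solution.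
by apply: pq_system_unique; exact: DLF_laplacianK.
Qed.
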